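(* Let $\mathcal{T}$ be an LTC-theory over a linear-time vocabulary $\Sigma$, let $I$ be a $\Sigma_s$-structure, and let $\varphi$ be a universal single-state sentence with time variable $t$. If $\mathcal{T}_0\wedge\neg te(\varphi)$ has no models expanding $I$, and $\mathcal{T}_t\wedge te(\varphi)\wedge\neg te(\varphi[\mathcal{S}(t)/t])$ has no models expanding $I$, then $\varphi$ is satisfied in every model of $\mathcal{T}$ that expands $I$.
   Context: Linear-time vocabulary: a many-typed first-order vocabulary $\Sigma$ with a type $\mathrm{Time}$, a constant $\mathcal{I}$ of type $\mathrm{Time}$ and a function $\mathcal{S}(\mathrm{Time}):\mathrm{Time}$; every other symbol has at most one argument of type $\mathrm{Time}$ (written last), and no function other than $\mathcal{I},\mathcal{S}$ has output type $\mathrm{Time}$. In all $\Sigma$-structures $\mathrm{Time}$ is $\mathbb{N}$, $\mathcal{I}$ is $0$, $\mathcal{S}$ is successor. Other symbols are static (no $\mathrm{Time}$ argument) or dynamic. The static vocabulary $\Sigma_s$ consists of the static symbols (and the types other than $\mathrm{Time}$); the single-state vocabulary $\Sigma_{ss}$ extends it with, for each dynamic $\sigma$, a symbol $\sigma^{\circ}$ with the $\mathrm{Time}$ argument removed; the bistate vocabulary $\Sigma_{bs}$ further adds a symbol $\sigma^{+}$ of the same signature as $\sigma^{\circ}$. Theories are FO(ID) theories: first-order sentences plus one definition (rules $\forall\bar x: P(\bar t)\leftarrow\varphi$ under the well-founded semantics). A sentence or rule is static if it has no $\mathrm{Time}$-terms; initial if its only $\mathrm{Time}$-term is $\mathcal{I}$;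 single-state if it contains a $\mathrm{Time}$ variable and no other $\mathrm{Time}$-terms; bistate if it contains a $\mathrm{Time}$ variable $t$ and all its $\mathrm{Time}$-terms are $t$ or $\mathcal{S}(t)$; universal if of the form $\forall t:\varphi'$ with $t$ its unique $\mathrm{Time}$ variable, not requantified in $\varphi'$. An LTC-theory is one in which every sentence and rule is static, initial, universal single-state or universal bistate, and whose definition is stratified over time. $\varphi[b/a]$ denotes replacing term $a$ by $b$. Time-elimination $te(\varphi)$ of a universal single-state or bistate $\varphi$ with time variable $t$: drop $\forall t$; replace each $\sigma(\dots,\mathcal{S}(t))$ by $\sigma^{+}(\dots)$ and each $\sigma(\dots,t)$ by $\sigma^{\circ}(\dots)$. The initial theory $\mathcal{T}_0$ (over $\Sigma_{ss}$) consists of the static sentences/rules of $\mathcal{T}$, $te(\forall t:\psi[t/\mathcal{I}])$ for each initial $\psi$, and $te(\psi)$ for each single-state $\psi$; the transition theory $\mathcal{T}_t$ (over $\Sigma_{bs}$) consists of the static sentences/rules of $\mathcal{T}$, $te(\psi)$ and $te(\psi[\mathcal{S}(t)/t])$ for each single-state $\psi$, and $te(\psi)$ for each bistate $\psi$. A structure expands $I$ if it has the same domains for the non-$\mathrm{Time}$ types and agrees with $I$ on $\Sigma_s$.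
   Formalization: ''Stratified over time'' is taken to require also that a predicate having a single-state rule has only single-state rules; without this the claim fails, e.g. for P(t)←q(t) together with P(S(t))←P(t). *)

(* Defs.v *)
From HB Require Import structures.
From mathcomp Require Import all_boot.
From mathcomp Require Import boolp classical_sets.

Set Implicit Arguments.
Unset Strict Implicit.
Unset Printing Implicit Defensive.

Local Open Scope classical_set_scope.

(* The argument places of a symbol form a finite type, so an argument tuple is
   a dependent function on argument places. *)
Record vocab := Vocab {
  sort : eqType;
  fsym : Type;
  far : fsym -> finType;
  fdom : forall f, far f -> sort;
  fcod : fsym -> sort;
  psym : Type;
  par : psym -> finType;
  pdom : forall p, par p -> sort }.

(* The variables of type [s] are the pairs [(s, x)] with [x : nat]. *)
Inductive term (V : vocab) : sort V -> Type :=
| Var (s : sort V) (x : nat) : term s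
| App (f : fsym V) (a : forall i : far f, term (fdom i)) : term (fcod f).

Arguments Var {V} s x.
Arguments App {V} f a.

(* With [U := @term V] these are the atomic formulas, with [U] the family of
   domains of a structure they are the domain atoms. *)
Record atom (V : vocab) (U : sort V -> Type) := Atom {
  asym : psym V;
  aargs : forall i : par asym, U (pdom i) }.

Arguments Atom {V U} asym aargs.
Arguments aargs {V U} a i.

Inductive form (V : vocab) :=
| Top
| Atm (a : atom (@term V))
| Eq (s : sort V) (u w : term s)
| Neg (A : form V)
| And (A B : form V)
| Or (A B : form V)
| All (s : sort V) (x : nat) (A : form V)
| Ex (s : sort V) (x : nat) (A : form V).

Arguments Top {V}.
Arguments All {V} s x A.
Arguments Ex {V} s x A.

Fixpoint free_term V (y : sort V * nat) s (u : term s) : Prop :=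
  match u with
  | Var s x => y = (s, x)
  | App f a => exists i, free_term y (a i)
  end.

Fixpoint free V (y : sort V * nat) (A : form V) : Prop :=
  match A with
  | Top => False
  | Atm a => exists i, free_term y (aargs a i)
  | Eq _ u w => free_term y u \/ free_term y w
  | Neg A => free y A
  | And A B | Or A B => free y A \/ free y B
  | All s x A | Ex s x A => y <> (s, x) /\ free y A
  end.

Definition sentence V (A : form V) : Prop := forall y, ~ free y A.

(* [Rule h b] stands for [forall xs : h <- b], with [xs] the list of all free
   variables of [h] and [b]. *)
Record rule (V : vocab) := Rule { rhead : atom (@term V); rbody : form V }.

Record theory (V : vocab) := Theory {
  sents : set (form V);
  defn : set (rule V) }.

Definition add_sent V (T : theory V) (A : form V) : theory V :=
  Theory (sents T `|` [set A]) (defn T).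

Record structure (V : vocab) := Structure {
  dom : sort V -> Type;
  dom_inh : forall s, inhabited (dom s);
  fint : forall f, (forall i : far f, dom (fdom i)) -> dom (fcod f);
  pint : forall p, (forall i : par p, dom (pdom i)) -> Prop }.

Section Semantics.
Variables (V : vocab) (M : structure V).

Definition valuation := forall s : sort V, nat -> dom M s.

Definition upd (v : valuation) (s : sort V) (x : nat) (d : dom M s) : valuation :=
  fun s' y => match s =P s' with
  | ReflectT e => if x == y then ecast z (dom M z) e d else v s' y
  | ReflectF _ => v s' y
  end.

Fixpoint eval (v : valuation) s (u : term s) : dom M s :=
  match u with
  | Var s x => v s x
  | App f a => fint (fun i => eval v (a i))
  end.

Definition eval_atom (v : valuation) (a : atom (@term V)) : atom (dom M) :=
  Atom (asym a) (fun i => eval v (aargs a i)).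

(* Positive occurrences of atoms are evaluated in [X], negative ones in [Y]. *)
Fixpoint holds (X Y : set (atom (dom M))) (v : valuation) (A : form V) : Prop :=
  match A with
  | Top => True
  | Atm a => X (eval_atom v a)
  | Eq _ u w => eval v u = eval v w
  | Neg A => ~ holds Y X v A
  | And A B => holds X Y v A /\ holds X Y v B
  | Or A B => holds X Y v A \/ holds X Y v B
  | All s x A => forall d, holds X Y (upd v x (s := s) d) A
  | Ex s x A => exists d, holds X Y (upd v x (s := s) d) A
  end.

Definition true_atoms : set (atom (dom M)) := [set a | pint (aargs a)].

Definition sat (A : form V) : Prop :=
  forall v : valuation, holds true_atoms true_atoms v A.

Definition lfp (F : set (atom (dom M)) -> set (atom (dom M))) :=
  \bigcap_(X in [set X | F X `<=` X]) X.

Section Definitions.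
Variable D : set (rule V).

Definition defined (p : psym V) : Prop := exists2 r, D r & asym (rhead r) = p.

Definition open_atoms : set (atom (dom M)) :=
  [set a | ~ defined (asym a) /\ true_atoms a].

Definition consequences (Y X : set (atom (dom M))) : set (atom (dom M)) :=
  open_atoms `|`
  [set a | exists r v,
     [/\ D r, a = eval_atom v (rhead r) & holds X Y v (rbody r)]].

Definition stable_op (Y : set (atom (dom M))) := lfp (consequences Y).

(* Van Gelder's alternating fixpoint, in the context given by the
   interpretation of the open symbols in [M]: an atom is true in the
   well-founded model if it is in [wf_true] and false if it is not in
   [wf_possible]. *)
Definition wf_true := lfp (fun X => stable_op (stable_op X)).
Definition wf_possible := stable_op wf_true.

Definition sat_defn : Prop :=
  wf_true = true_atoms /\ wf_possible = true_atoms.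
End Definitions.

Definition models (T : theory V) : Prop :=
  (forall A, sents T A -> sat A) /\ sat_defn (defn T).
End Semantics.

(* The types other than Time, and the static and dynamic symbols other than I
   and S; the Time argument of the dynamic symbols is left implicit. *)
Record ltvoc := LTVoc {
  lsort : eqType;
  sfsym : Type;
  sfar : sfsym -> finType;
  sfdom : forall f, sfar f -> lsort;
  sfcod : sfsym -> lsort;
  dfsym : Type;
  dfar : dfsym -> finType;
  dfdom : forall f, dfar f -> lsort;
  dfcod : dfsym -> lsort;
  spsym : Type;
  spar : spsym -> finType;
  spdom : forall p, spar p -> lsort;
  dpsym : Type;
  dpar : dpsym -> finType;
  dpdom : forall p, dpar p -> lsort }.

Inductive lt_fsym (L : ltvoc) :=
| Init | Succ | SFun of sfsym L | DFun of dfsym L.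
Inductive lt_psym (L : ltvoc) :=
| SPred of spsym L | DPred of dpsym L.

Arguments Init {L}.
Arguments Succ {L}.

Section LinearTime.
Variable L : ltvoc.

(* [None] is the type Time; as an argument place of a dynamic symbol, [None] is
   the place of the Time argument. *)
Definition lt_far (f : lt_fsym L) : finType :=
  match f with
  | Init => void
  | Succ => unit
  | SFun f => sfar f
  | DFun f => option (dfar f)
  end.

Definition lt_fdom (f : lt_fsym L) : lt_far f -> option (lsort L) :=
  match f with
  | Init => fun _ => None
  | Succ => fun _ => None
  | SFun f => fun i => Some (sfdom i)
  | DFun f => omap (@dfdom L f)
  end.

Definition lt_fcod (f : lt_fsym L) : option (lsort L) :=
  match f with
  | Init | Succ => None
  | SFun f => Some (sfcod f)
  | DFun f => Some (dfcod f)
  end.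

Definition lt_par (p : lt_psym L) : finType :=
  match p with
  | SPred p => spar p
  | DPred p => option (dpar p)
  end.

Definition lt_pdom (p : lt_psym L) : lt_par p -> option (lsort L) :=
  match p with
  | SPred p => fun i => Some (spdom i)
  | DPred p => omap (@dpdom L p)
  end.

Definition lt_vocab : vocab :=
  @Vocab (option (lsort L)) (lt_fsym L) lt_far lt_fdom lt_fcod
         (lt_psym L) lt_par lt_pdom.

Definition static_vocab : vocab :=
  @Vocab (lsort L) (sfsym L) (@sfar L) (@sfdom L) (@sfcod L)
         (spsym L) (@spar L) (@spdom L).

(* The static symbols, and one copy of each dynamic symbol, without its Time
   argument, for each element of [K]. *)
Definition state_vocab (K : Type) : vocab :=
  @Vocab (lsort L)
    (sfsym L + K * dfsym L)
    (fun f => match f with inl f => sfar f | inr f => dfar f.2 end)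
    (fun f => match f with inl f => @sfdom L f | inr f => @dfdom L f.2 end)
    (fun f => match f with inl f => sfcod f | inr f => dfcod f.2 end)
    (spsym L + K * dpsym L)
    (fun p => match p with inl p => spar p | inr p => dpar p.2 end)
    (fun p => match p with inl p => @spdom L p | inr p => @dpdom L p.2 end).

Definition ss_vocab := state_vocab unit.

(* [false] is the copy of the current state, [true] that of the next state. *)
Definition bs_vocab := state_vocab bool.

Record lt_structure := LTStructure {
  ldom : lsort L -> Type;
  ldom_inh : forall s, inhabited (ldom s);
  sfint : forall f, (forall i : sfar f, ldom (sfdom i)) -> ldom (sfcod f);
  dfint : forall f,
    (forall i : dfar f, ldom (dfdom i)) -> nat -> ldom (dfcod f);
  spint : forall p, (forall i : spar p, ldom (spdom i)) -> Prop;
  dpint : forall p, (forall i : dpar p, ldom (dpdom i)) -> nat -> Prop }.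

Section LTStructures.
Variable M : lt_structure.

Definition lt_dom (s : option (lsort L)) : Type :=
  if s is Some s then ldom M s else nat.

Lemma lt_dom_inh s : inhabited (lt_dom s).
Proof. by case: s => [s|]; [apply: ldom_inh | exists; exact: 0]. Qed.

Definition lt_fint (f : lt_fsym L) :
    (forall i : lt_far f, lt_dom (lt_fdom i)) -> lt_dom (lt_fcod f) :=
  match f with
  | Init => fun _ => 0
  | Succ => fun a => (a tt).+1
  | SFun f => fun a => sfint a
  | DFun f => fun a => dfint (fun i => a (Some i)) (a None)
  end.

Definition lt_pint (p : lt_psym L) :
    (forall i : lt_par p, lt_dom (lt_pdom i)) -> Prop :=
  match p with
  | SPred p => fun a => spint a
  | DPred p => fun a => dpint (fun i => a (Some i)) (a None)
  end.

Definition lt_str : structure lt_vocab :=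
  @Structure lt_vocab lt_dom lt_dom_inh lt_fint lt_pint.

Definition lt_static : structure static_vocab :=
  @Structure static_vocab (ldom M) (@ldom_inh M) (@sfint M) (@spint M).
End LTStructures.

Definition state_static K (J : structure (state_vocab K)) :
    structure static_vocab :=
  @Structure static_vocab (dom J) (@dom_inh _ J)
    (fun f => @fint _ J (inl f)) (fun p => @pint _ J (inl p)).

Definition lt_expands (M : lt_structure) (I : structure static_vocab) : Prop :=
  lt_static M = I.

Definition expands K (J : structure (state_vocab K))
    (I : structure static_vocab) : Prop :=
  state_static J = I.

Inductive tterm := TVar of nat | TInit | TSucc of tterm.

Fixpoint time_of s (u : @term lt_vocab s) : (if s is Some _ then unit else tterm) :=
  match u in term s return (if s is Some _ then unit else tterm) with
  | Var s x => match s with Some _ => tt | None => TVar x end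
  | App f a =>
    match f return (forall i : lt_far f, @term lt_vocab (lt_fdom i)) ->
                   (if lt_fcod f is Some _ then unit else tterm) with
    | Init => fun _ => TInit
    | Succ => fun a => TSucc (time_of (a tt))
    | SFun _ | DFun _ => fun _ => tt
    end a
  end.

Section TimesIn.
Variable P : tterm -> Prop.

Fixpoint term_times s (u : @term lt_vocab s) : Prop :=
  match u with
  | Var s x => if s is Some _ then True else P (TVar x)
  | App f a => 
    match f return (forall i : lt_far f, @term lt_vocab (lt_fdom i)) -> Prop with
    | Init => fun _ => P TInit
    | Succ => fun a => P (TSucc (time_of (a tt)))
    | SFun f => fun a => forall i, term_times (a i)
    | DFun f => fun a => forall i, term_times (a i)
    end a
  end.

Definition atom_times (a : atom (@term lt_vocab)) : Prop :=
  forall i, term_times (aargs a i).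

(* All maximal Time-terms satisfy [P]. Quantification over Time and equality
   between Time-terms, which has two arguments of type Time, are excluded. *)
Fixpoint times (A : form lt_vocab) : Prop :=
  match A with
  | Top => True
  | Atm a => atom_times a
  | Eq s u w => [/\ s <> None, term_times u & term_times w]
  | Neg A => times A
  | And A B | Or A B => times A /\ times B
  | All s _ A | Ex s _ A => s <> None /\ times A
  end.

Definition rule_times (r : rule lt_vocab) : Prop :=
  atom_times (rhead r) /\ times (rbody r).
End TimesIn.

Definition is_cur (t : nat) (u : tterm) : Prop := u = TVar t.
Definition is_cur_next (t : nat) (u : tterm) : Prop :=
  u = TVar t \/ u = TSucc (TVar t).

Definition static (A : form lt_vocab) : Prop := times (fun _ => False) A.
Definition initial (A : form lt_vocab) : Prop :=
  ~ static A /\ times (fun u => u = TInit) A.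
Definition univ_single_state (t : nat) (A : form lt_vocab) : Prop :=
  exists2 B, A = @All lt_vocab None t B & times (is_cur t) B.
Definition univ_bistate (t : nat) (A : form lt_vocab) : Prop :=
  exists2 B, A = @All lt_vocab None t B & times (is_cur_next t) B.

Definition rule_static (r : rule lt_vocab) : Prop :=
  rule_times (fun _ => False) r.
Definition rule_initial (r : rule lt_vocab) : Prop :=
  ~ rule_static r /\ rule_times (fun u => u = TInit) r.
Definition rule_single_state (t : nat) (r : rule lt_vocab) : Prop :=
  ~ rule_static r /\ rule_times (is_cur t) r.
Definition rule_bistate (t : nat) (r : rule lt_vocab) : Prop :=
  ~ rule_static r /\ rule_times (is_cur_next t) r.

Definition head_time (r : rule lt_vocab) : option tterm :=
  match rhead r with
  | Atom (SPred p) a => None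
  | Atom (DPred p) a => Some (time_of (a None))
  end.

(* First clause: a static predicate is defined in terms of static symbols only,
   and a rule for [P(.., t)] does not refer to [S(t)]. The rules with head
   [P(.., I)] or [P(.., S(t))] need no condition, being initial or bistate.
   Second clause: a predicate that has single-state rules has no other rules, so
   that these define it at every time point; otherwise it is defined by initial
   rules at I and by bistate rules at successors. With [P(t) <- q(t)] and
   [P(S(t)) <- P(t)] together, the transition theory would wrongly define the
   current-state copy of P by the first rule only. *)
Definition stratified_over_time (D : set (rule lt_vocab)) : Prop :=
  (forall r, D r -> match head_time r with
                    | None => rule_static r
                    | Some (TVar t) => rule_single_state t r
                    | Some _ => True
                    end) /\
  (forall r r', D r -> D r' -> asym (rhead r) = asym (rhead r') ->
     (exists t, rule_single_state t r) -> exists t, rule_single_state t r').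

Definition ltc_theory (T : theory lt_vocab) : Prop :=
  [/\ forall A, sents T A -> sentence A,
      forall A, sents T A ->
        [\/ static A, initial A, exists t, univ_single_state t A
          | exists t, univ_bistate t A],
      forall r, defn T r ->
        [\/ rule_static r, rule_initial r, exists t, rule_single_state t r
          | exists t, rule_bistate t r]
    & stratified_over_time (defn T)].

Section Replacement.
(* Replaces each Time-variable [x] by [h x] and [I] by [c]; this also replaces
   bound occurrences. *)
Variables (h : nat -> @term lt_vocab None) (c : @term lt_vocab None).

Fixpoint repl_term s (u : @term lt_vocab s) : @term lt_vocab s :=
  match u in term s return @term lt_vocab s with
  | Var s x => match s with
               | Some s => @Var lt_vocab (Some s) x
               | None => h x
               end
  | App f a =>
    match f return (forall i : lt_far f, @term lt_vocab (lt_fdom i)) ->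
                   @term lt_vocab (lt_fcod f) with
    | Init => fun _ => c
    | f => fun a => @App lt_vocab f (fun i => repl_term (a i))
    end a
  end.

Definition repl_atom (a : atom (@term lt_vocab)) : atom (@term lt_vocab) :=
  Atom (asym a) (fun i => repl_term (aargs a i)).

Fixpoint repl (A : form lt_vocab) : form lt_vocab :=
  match A with
  | Top => Top
  | Atm a => Atm (repl_atom a)
  | Eq s u w => Eq (repl_term u) (repl_term w)
  | Neg A => Neg (repl A)
  | And A B => And (repl A) (repl B)
  | Or A B => Or (repl A) (repl B)
  | All s x A => All s x (repl A)
  | Ex s x A => Ex s x (repl A)
  end.

Definition repl_rule (r : rule lt_vocab) : rule lt_vocab :=
  Rule (repl_atom (rhead r)) (repl (rbody r)).
End Replacement.

Definition tvar (t : nat) : @term lt_vocab None := @Var lt_vocab None t.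
Definition tinit : @term lt_vocab None :=
  @App lt_vocab Init (fun i : void => match i with end).
Definition tsucc (u : @term lt_vocab None) : @term lt_vocab None :=
  @App lt_vocab Succ (fun _ => u).

Definition next_var (t x : nat) := if x == t then tsucc (tvar t) else tvar x.

(* [A[S(t)/t]] *)
Definition shift t := repl (next_var t) tinit.
Definition rule_shift t := repl_rule (next_var t) tinit.

(* [A[t/I]] *)
Definition uninit t := repl tvar (tvar t).
Definition rule_uninit t := repl_rule tvar (tvar t).

Section TimeElimination.
(* [k u] is the copy of the dynamic symbols that is used at the Time-term [u]. *)
Variables (K : Type) (k : tterm -> K).

Fixpoint te_term s (u : @term lt_vocab s) :
    (if s is Some s then @term (state_vocab K) s else unit) :=
  match u in term s
    return (if s is Some s then @term (state_vocab K) s else unit) with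
  | Var s x => match s with
               | Some s => @Var (state_vocab K) s x
               | None => tt
               end
  | App f a =>
    match f return (forall i : lt_far f, @term lt_vocab (lt_fdom i)) ->
        (if lt_fcod f is Some s then @term (state_vocab K) s else unit) with
    | Init | Succ => fun _ => tt
    | SFun f => fun a => @App (state_vocab K) (inl f) (fun i => te_term (a i))
    | DFun f => fun a => @App (state_vocab K) (inr (k (time_of (a None)), f))
                              (fun i => te_term (a (Some i)))
    end a
  end.

Definition te_atom (a : atom (@term lt_vocab)) : atom (@term (state_vocab K)) :=
  match a with
  | Atom (SPred p) a =>
      @Atom (state_vocab K) _ (inl p) (fun i => te_term (a i))
  | Atom (DPred p) a =>
      @Atom (state_vocab K) _ (inr (k (time_of (a None)), p))
            (fun i => te_term (a (Some i)))
  end.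

(* Equalities between Time-terms do not occur in the formulas that this is used
   for. On static formulas this is the identity. *)
Fixpoint te (A : form lt_vocab) : form (state_vocab K) :=
  match A with
  | Top => Top
  | Atm a => Atm (te_atom a)
  | Eq s u w =>
    match s return @term lt_vocab s -> @term lt_vocab s -> _ with
    | Some s => fun u w => @Eq (state_vocab K) s (te_term u) (te_term w)
    | None => fun _ _ => Top
    end u w
  | Neg A => Neg (te A)
  | And A B => And (te A) (te B)
  | Or A B => Or (te A) (te B)
  | All s x A => if s is Some s then @All (state_vocab K) s x (te A) else te A
  | Ex s x A => if s is Some s then @Ex (state_vocab K) s x (te A) else te A
  end.

Definition te_rule (r : rule lt_vocab) : rule (state_vocab K) :=
  Rule (te_atom (rhead r)) (te (rbody r)).
End TimeElimination.

Definition is_succ (u : tterm) : bool := if u is TSucc _ then true else false.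

Definition te_ss : form lt_vocab -> form ss_vocab := te (fun _ => tt).
Definition te_rule_ss : rule lt_vocab -> rule ss_vocab := te_rule (fun _ => tt).
Definition te_bs : form lt_vocab -> form bs_vocab := te is_succ.
Definition te_rule_bs : rule lt_vocab -> rule bs_vocab := te_rule is_succ.

(* The Time-variable 0 is arbitrary here: initial sentences and rules contain no
   Time-variables. *)
Definition initial_theory (T : theory lt_vocab) : theory ss_vocab :=
  Theory
    ([set te_ss A | A in [set A | sents T A /\ static A]] `|`
     [set te_ss (@All lt_vocab None 0 (uninit 0 A))
        | A in [set A | sents T A /\ initial A]] `|`
     [set te_ss A | A in [set A | sents T A /\ exists t, univ_single_state t A]])
    ([set te_rule_ss r | r in [set r | defn T r /\ rule_static r]] `|`
     [set te_rule_ss (rule_uninit 0 r)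
        | r in [set r | defn T r /\ rule_initial r]] `|`
     [set te_rule_ss r
        | r in [set r | defn T r /\ exists t, rule_single_state t r]]).

Definition transition_theory (T : theory lt_vocab) : theory bs_vocab :=
  Theory
    ([set te_bs A | A in [set A | sents T A /\ static A]] `|`
     [set te_bs A | A in [set A | sents T A /\ exists t, univ_single_state t A]] `|`
     [set B | exists A t, [/\ sents T A, univ_single_state t A
                            & B = te_bs (shift t A)]] `|`
     [set te_bs A | A in [set A | sents T A /\ exists t, univ_bistate t A]])
    ([set te_rule_bs r | r in [set r | defn T r /\ rule_static r]] `|`
     [set te_rule_bs r
        | r in [set r | defn T r /\ exists t, rule_single_state t r]] `|`
     [set r' | exists r t, [/\ defn T r, rule_single_state t r
                             & r' = te_rule_bs (rule_shift t r)]] `|`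
     [set te_rule_bs r | r in [set r | defn T r /\ exists t, rule_bistate t r]]).
End LinearTime.

(* Main.v *)
(* Induction on time.  The snapshot of a model M of T at time 0 is a model of
   T_0, and the pair of its snapshots at times n and n+1 is a model of T_t, so
   the two hypotheses give phi at 0 and carry it from n to n+1.

   The delicate point is that a snapshot satisfies the projected definition
   under the well-founded semantics.  Let W be the true atoms of M and A the
   stable operator, so that W = A(W) and W is the least prefixpoint of A o A.
   Sets of snapshot atoms are extended to M by taking W outside the snapshot.
   Every instance in M of a rule whose head lies in the snapshot and is defined
   there comes from a projected rule, by stratification; atoms of the snapshot
   that are not defined there are open and keep their value in W.  Hence
   prefixpoints of the projected operators extend to M, where they contain W. *)
From mathcomp Require Import all_boot.
From mathcomp Require Import boolp classical_sets.
Require Import Defs.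

Set Implicit Arguments.
Unset Strict Implicit.
Unset Printing Implicit Defensive.

Local Open Scope classical_set_scope.

(** * Valuations, monotonicity and the stable operator *)

Section Semantics.
Variables (V : vocab) (M : structure V).
Implicit Types (v : valuation M) (X Y Z : set (atom (dom M))).

Lemma updE v s x d : upd v x (s := s) d s x = d.
Proof.
rewrite /upd; case: eqP => // e.
by rewrite eqxx (eq_irrelevance e erefl).
Qed.

Lemma upd_neq v s x (d : dom M s) s' y :
  (s', y) <> (s, x) -> upd v x d s' y = v s' y.
Proof.
move=> ne; rewrite /upd; case: eqP => // e; subst s'.
by case: eqP => // exy; case: ne; rewrite exy.
Qed.

Lemma upd_id v s x : upd v x (v s x) = v.
Proof.
apply: functional_extensionality_dep => s'; apply: functional_extensionality_dep => y.
have [[-> ->]|ne] := pselect ((s', y) = (s, x)); first exact: updE.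
exact: upd_neq.
Qed.

(** [sat] already ranges over all valuations; this is why time-elimination may drop the outer
    quantifier over Time. *)
Lemma sat_All s x (A : form V) : sat M (All s x A) <-> sat M A.
Proof.
split=> h v; last by move=> d; apply: h.
by have := h v (v s x); rewrite upd_id.
Qed.

Lemma eq_eval v v' s (u : term s) :
  (forall y, free_term y u -> v y.1 y.2 = v' y.1 y.2) -> eval v u = eval v' u.
Proof.
elim: u => [s' x|f a IH] h /=; first exact: (h (s', x)).
congr fint; apply: functional_extensionality_dep => i.
by apply: IH => y hy; apply: h; exists i.
Qed.

Lemma eq_holds X Y v v' (A : form V) :
  (forall y, free y A -> v y.1 y.2 = v' y.1 y.2) ->
  holds X Y v A = holds X Y v' A.
Proof.
elim: A X Y v v' => [|a|s u w|A IH|A IHA B IHB|A IHA B IHB|s x A IH|s x A IH]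
  X Y v v' h //=.
- congr (X _); rewrite /eval_atom; congr Atom.
  apply: functional_extensionality_dep => i.
  by apply: eq_eval => y hy; apply: h; exists i.
- by congr (_ = _); apply: eq_eval => y hy; apply: h; [left|right].
- by rewrite (IH _ _ _ v').
- by rewrite (IHA _ _ _ v') 1?(IHB _ _ _ v') // => y hy; apply: h; [right|left].
- by rewrite (IHA _ _ _ v') 1?(IHB _ _ _ v') // => y hy; apply: h; [right|left].
- have E d : holds X Y (upd v x (s := s) d) A = holds X Y (upd v' x d) A.
    apply: IH => -[s' y] hy /=.
    have [[-> ->]|ne] := pselect ((s', y) = (s, x)); first by rewrite !updE.
    by rewrite !upd_neq //; apply: (h (s', y)).
  by apply: propext; split=> H d; have := H d; rewrite E.
- have E d : holds X Y (upd v x (s := s) d) A = holds X Y (upd v' x d) A.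
    apply: IH => -[s' y] hy /=.
    have [[-> ->]|ne] := pselect ((s', y) = (s, x)); first by rewrite !updE.
    by rewrite !upd_neq //; apply: (h (s', y)).
  by apply: propext; split=> -[d H]; exists d; move: H; rewrite E.
Qed.

Lemma holds_mono X X' Y Y' v (A : form V) :
  X `<=` X' -> Y' `<=` Y -> holds X Y v A -> holds X' Y' v A.
Proof.
elim: A X X' Y Y' v => [|a|s u w|A IH|A IHA B IHB|A IHA B IHB|s x A IH|s x A IH]
  X X' Y Y' v sX sY //=.
- exact: sX.
- by move=> h h'; apply: h; apply: IH h'.
- by move=> [hA hB]; split; [apply: IHA hA|apply: IHB hB].
- by move=> [hA|hB]; [left; apply: IHA hA|right; apply: IHB hB].
- by move=> h d; apply: IH (h d).
- by move=> [d h]; exists d; apply: IH h.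
Qed.

Lemma lfp_sub (F : set (atom (dom M)) -> set (atom (dom M))) X : F X `<=` X -> lfp F `<=` X.
Proof. by move=> h; apply: bigcap_inf. Qed.

Lemma lfp_prefixed (F : set (atom (dom M)) -> set (atom (dom M))) : {homo F : X Y / X `<=` Y} -> F (lfp F) `<=` lfp F.
Proof.
move=> mF a ha X hX; apply: (hX); apply: mF ha; exact: lfp_sub.
Qed.

Section Definitions.
Variable D : set (rule V).

Lemma consequences_mono Y Y' : Y' `<=` Y ->
  forall X X', X `<=` X' ->
  consequences D Y X `<=` consequences D Y' X'.
Proof.
move=> sY X X' sX a [ha|[r [v [Dr -> hb]]]]; [by left|right].
by exists r, v; split=> //; apply: holds_mono hb.
Qed.

Lemma stable_op_prefixed Y :
  consequences D Y (stable_op D Y) `<=` stable_op D Y.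
Proof. by apply: lfp_prefixed; apply: consequences_mono. Qed.

Lemma stable_op_anti Y Y' : Y' `<=` Y -> stable_op D Y `<=` stable_op D Y'.
Proof.
move=> sY; apply: lfp_sub; apply: subset_trans (@stable_op_prefixed Y').
exact: consequences_mono.
Qed.

(** The stable operator is antitone, so its square is monotone and the least-fixpoint argument
    applies. *)
Lemma wf_true_prefixed :
  stable_op D (stable_op D (wf_true D)) `<=` wf_true (M := M) D.
Proof.
by apply: lfp_prefixed => X Y sXY; apply: stable_op_anti; apply: stable_op_anti.
Qed.

End Definitions.
End Semantics.

(** * Passing well-founded models from a structure to a snapshot *)

Section Projection.
Variables (V V' : vocab) (M : structure V) (J : structure V').
Variables (D : set (rule V)) (D' : set (rule V')).
Variable e : atom (dom J) -> atom (dom M).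

(* [e] embeds the domain atoms of a snapshot [J] into those of [M]. *)
Definition simulates (r' : rule V') (v' : valuation J)
    (r : rule V) (v : valuation M) : Prop :=
  e (eval_atom v' (rhead r')) = eval_atom v (rhead r) /\
  forall X Y, holds (e @^-1` X) (e @^-1` Y) v' (rbody r') <->
              holds X Y v (rbody r).

Hypothesis true_e : true_atoms (M := J) = e @^-1` true_atoms (M := M).
Hypothesis defined_e : forall a, defined D' (asym a) -> defined D (asym (e a)).
Hypothesis lift_rule : forall r' v', D' r' ->
  exists r v, D r /\ simulates r' v' r v.
(** Restricted to predicates defined by [D']: in the transition theory, a predicate given by initial
    and bistate rules has an open current-state copy, and rule instances with such a head have no
    projected counterpart. *)
Hypothesis lower_rule : forall r v a, D r -> eval_atom v (rhead r) = e a ->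
  defined D' (asym a) ->
  exists r' v', [/\ D' r', a = eval_atom v' (rhead r') & simulates r' v' r v].

Let W := true_atoms (M := M).

Hypothesis satD : sat_defn M D.

Let stable_W : stable_op D W = W.
Proof. by have [t p] := satD; rewrite -[RHS]p /wf_possible t. Qed.

(* Only one inclusion holds in each of the two comparisons of the stable
   operators of [M] and [J]: atoms of [M] outside the snapshot may depend on
   atoms inside it, so their values are only controlled on one side of [W]. *)
Lemma stable_op_project U (U' : set (atom (dom J))) :
  W `<=` U -> U' `<=` e @^-1` U -> e @^-1` stable_op D U `<=` stable_op D' U'.
Proof.
move=> sWU sU; set S := stable_op D' U'.
(* [X] is [W] outside the snapshot and [W] cut down to [S] inside it. It contains [stable_op D U]
   because it is closed under the consequences relative to [U]. *)
pose X := [set a | W a /\ forall a', e a' = a -> S a'].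
have eX : e @^-1` X `<=` S by move=> a [_]; apply.
suff sX : stable_op D U `<=` X by move=> a /sX /eX.
have inS a' : ~ defined D' (asym a') -> W (e a') -> S a'.
  move=> nd Wa; apply: stable_op_prefixed; left; split=> //.
  by rewrite true_e.
apply: lfp_sub => a [[nd Wa]|[r [v [Dr -> hb]]]].
  by split=> // a' ea; apply: inS; rewrite ?ea // => /defined_e; rewrite ea.
(* Since [X] lies below [W] and [U] above it, the body stays true when all its atoms are evaluated
   in [W]. *)
have Wh : W (eval_atom v (rhead r)).
  rewrite -stable_W; apply: stable_op_prefixed; right; exists r, v; split=> //.
  by apply: holds_mono hb => // b; rewrite stable_W => -[].
split=> // a' ea; have [df|nd] := pselect (defined D' (asym a')); last first.
  by apply: inS; rewrite ?ea.
have [r' [v' [Dr' -> [_ hr]]]] := lower_rule Dr (esym ea) df.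
apply: stable_op_prefixed; right; exists r', v'; split=> //.
by move/hr: hb; apply: holds_mono.
Qed.

(** An atom open in the snapshot may be defined in [M]. If true it is still derived there, because
    it lies in [W = stable_op D W], and [Z] below [W] gives [stable_op D Z] above [W]. *)
Lemma stable_op_lift Z (Z' : set (atom (dom J))) :
  Z `<=` W -> e @^-1` Z `<=` Z' -> stable_op D' Z' `<=` e @^-1` stable_op D Z.
Proof.
move=> sZW sZ; apply: lfp_sub => a [[_ Wa]|[r' [v' [Dr' -> hb]]]].
  move: Wa; rewrite true_e /= -/W -stable_W; exact: stable_op_anti.
have [r [v [Dr [hh hr]]]] := lift_rule v' Dr'.
rewrite /= hh; apply: stable_op_prefixed; right; exists r, v; split=> //.
by apply/hr; apply: holds_mono hb.
Qed.

Lemma sat_defn_project : sat_defn J D'.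
Proof.
pose W' := e @^-1` W.
have stable_W' : stable_op D' W' = W'.
  rewrite eqEsubset; split.
    by rewrite {2}/W' -stable_W; apply: stable_op_lift.
  by rewrite {1}/W' -stable_W; apply: stable_op_project.
suff E : wf_true (M := J) D' = W' by rewrite /sat_defn /wf_possible E stable_W' true_e.
have sW' : wf_true (M := J) D' `<=` W' by apply: lfp_sub; rewrite !stable_W'.
rewrite eqEsubset; split=> //.
(* [Z] is [W] with its snapshot part cut down to the well-founded truths of [J]. By minimality of
   [W], it is enough that the squared stable operator maps [Z] into itself. *)
pose Z := [set a | W a /\ forall a', e a' = a -> wf_true (M := J) D' a'].
have sZW : Z `<=` W by move=> a [].
have eZ : e @^-1` Z `<=` wf_true (M := J) D' by move=> a [_]; apply.
suff sZ : W `<=` Z by move=> a /sZ /eZ.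
rewrite {1}/W -(proj1 satD); apply: lfp_sub => a Sa; split.
  by rewrite -stable_W -{1}stable_W; apply: stable_op_anti Sa; apply: stable_op_anti.
move=> a' ea; apply: wf_true_prefixed.
(* The intermediate set [stable_op D Z] contains [W] by antitonicity, and by [stable_op_lift] it
   bounds the corresponding stage in [J]. *)
apply: (@stable_op_project (stable_op D Z)); last by rewrite /= ea.
  by rewrite -{1}stable_W; apply: stable_op_anti.
exact: stable_op_lift.
Qed.

End Projection.

(** * Time-terms, time-elimination and snapshots *)

Section Snapshots.
Variable L : ltvoc.

Fixpoint teval (w : nat -> nat) (u : tterm) : nat :=
  match u with
  | TVar x => w x
  | TInit => 0
  | TSucc u => (teval w u).+1
  end.

(** Only [Init] and [Succ] have output type Time, so a Time-term is its own unique maximal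
    Time-term. *)
Lemma term_times_None (P : tterm -> Prop) (u : @term (lt_vocab L) None) :
  term_times P u = P (time_of u).
Proof.
move: u; suff H s (u : @term (lt_vocab L) s) :
  match s return @term (lt_vocab L) s -> Prop with
  | Some _ => fun _ => True
  | None => fun u => term_times P u = P (time_of u)
  end u by exact: (H None).
by case: u => [[s'|] x|[||f|f] a].
Qed.

Lemma term_times_mono (P Q : tterm -> Prop) s (u : @term (lt_vocab L) s) :
  (forall x, P x -> Q x) -> term_times P u -> term_times Q u.
Proof.
move=> sPQ; elim: u => [[s'|] x|[||f|f] a IH] //=; try exact: sPQ.
- by move=> h i; apply: (IH i (h i)).
- by move=> h i; apply: (IH i (h i)).
Qed.

Lemma times_mono (P Q : tterm -> Prop) (A : form (lt_vocab L)) :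
  (forall x, P x -> Q x) -> times P A -> times Q A.
Proof.
move=> sPQ; have mt := fun s u => @term_times_mono P Q s u sPQ.
elim: A => [|a|s u w|A IH|A IHA B IHB|A IHA B IHB|s x A IH|s x A IH] //=.
- by move=> h i; apply: mt.
- by move=> [? ? ?]; split=> //; apply: mt.
- by move=> [? ?]; split; [apply: IHA|apply: IHB].
- by move=> [? ?]; split; [apply: IHA|apply: IHB].
- by move=> [? ?]; split=> //; apply: IH.
- by move=> [? ?]; split=> //; apply: IH.
Qed.

Lemma rule_times_mono (P Q : tterm -> Prop) (r : rule (lt_vocab L)) :
  (forall x, P x -> Q x) -> rule_times P r -> rule_times Q r.
Proof.
move=> sPQ [hh hb]; split; last exact: times_mono hb.
by move=> i; apply: term_times_mono (hh i).
Qed.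

Lemma head_time_times (P : tterm -> Prop) (r : rule (lt_vocab L)) u :
  rule_times P r -> head_time r = Some u -> P u.
Proof.
case: r => [[[p|p] a] b] // [/= hh _] [<-].
by rewrite -term_times_None; apply: (hh None).
Qed.

Section TimeSubstitution.
Variables (h : nat -> @term (lt_vocab L) None) (c : @term (lt_vocab L) None).
Variables (K : Type) (k k' : tterm -> K).

Fixpoint trepl (u : tterm) : tterm :=
  match u with
  | TVar x => time_of (h x)
  | TInit => time_of c
  | TSucc u => TSucc (trepl u)
  end.

Lemma time_of_repl (u : @term (lt_vocab L) None) :
  time_of (repl_term h c u) = trepl (time_of u).
Proof.
move: u; suff H s (u : @term (lt_vocab L) s) :
  match s return @term (lt_vocab L) s -> Prop with
  | Some _ => fun _ => True
  | None => fun u => time_of (repl_term h c u) = trepl (time_of u)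
  end u by exact: (H None).
elim: u => [[s'|] x|[||f|f] a IH] //=.
by congr TSucc; apply: (IH tt).
Qed.

(** Replacing Time-terms and then eliminating time amounts to eliminating time with another choice
    of copies, as long as the two choices agree on the Time-terms that occur. *)
Let P u := k (trepl u) = k' u.

Lemma te_repl_term s (u : @term (lt_vocab L) s) :
  term_times P u -> te_term k (repl_term h c u) = te_term k' u.
Proof.
elim: u => [[s'|] x|[||f|f] a IH] //=.
- by move=> _; case: (te_term _ _).
- by move=> _; case: (te_term _ _).
- move=> hP; apply: (congr1 (@App (state_vocab L K) (inl f))).
  apply: functional_extensionality_dep => i.
  exact: (IH i (hP i)).
- move=> hP; rewrite time_of_repl.
  have := hP None; rewrite term_times_None => ->.
  apply: (congr1 (@App (state_vocab L K) (inr (_, f)))).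
  apply: functional_extensionality_dep => i.
  exact: (IH (Some i) (hP (Some i))).
Qed.

Lemma te_repl_atom (a : atom (@term (lt_vocab L))) :
  atom_times P a -> te_atom k (repl_atom h c a) = te_atom k' a.
Proof.
case: a => [[p|p] a] hP /=.
  congr Atom; apply: functional_extensionality_dep => i.
  exact: (te_repl_term (hP i)).
rewrite time_of_repl; have := hP None; rewrite term_times_None => ->.
congr Atom; apply: functional_extensionality_dep => i.
exact: (te_repl_term (hP (Some i))).
Qed.

Lemma te_repl (A : form (lt_vocab L)) :
  times P A -> te k (repl h c A) = te k' A.
Proof.
elim: A => [|a|s u w|A IH|A IHA B IHB|A IHA B IHB|s x A IH|s x A IH] //=.
- by move=> hP; congr Atm; apply: te_repl_atom.
- case: s u w => [s|] u w [//= _ hu hw].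
  by rewrite (te_repl_term hu) (te_repl_term hw).
- by move=> /IH->.
- by move=> [/IHA-> /IHB->].
- by move=> [/IHA-> /IHB->].
- by case: s => [s|] [//= _ /IH->].
- by case: s => [s|] [//= _ /IH->].
Qed.

Lemma te_repl_rule (r : rule (lt_vocab L)) :
  rule_times P r -> te_rule k (repl_rule h c r) = te_rule k' r.
Proof. by move=> [hh hb]; congr Rule; [apply: te_repl_atom|apply: te_repl]. Qed.

End TimeSubstitution.

Variables (M : lt_structure L) (K : Type) (tm : K -> nat).

(** [tm c] is the time point whose state is described by the copy [c], so one construction serves
    both the initial and the transition theory. *)
Definition snapshot_fint (f : fsym (state_vocab L K)) :
    (forall i : far f, ldom M (fdom i)) -> ldom M (fcod f) :=
  match f with
  | inl f => fun a => sfint a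
  | inr f => fun a => dfint a (tm f.1)
  end.

Definition snapshot_pint (p : psym (state_vocab L K)) :
    (forall i : par p, ldom M (pdom i)) -> Prop :=
  match p with
  | inl p => fun a => spint a
  | inr p => fun a => dpint a (tm p.1)
  end.

Definition snapshot : structure (state_vocab L K) :=
  @Structure (state_vocab L K) (ldom M) (@ldom_inh L M)
    snapshot_fint snapshot_pint.

Notation LM := (lt_str M).

Definition embed_atom (a : atom (dom snapshot)) : atom (dom LM) :=
  match a with
  | Atom (inl p) a => @Atom (lt_vocab L) (dom LM) (SPred p) a
  | Atom (inr p) a =>
    @Atom (lt_vocab L) (dom LM) (DPred p.2)
      (fun i : option (dpar p.2) =>
         match i return lt_dom M (omap (@dpdom L p.2) i) with
         | Some i => a i
         | None => tm p.1
         end)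
  end.

Definition restr (v : valuation LM) : valuation snapshot :=
  fun s => v (Some s).

Definition extend (v : valuation snapshot) (n : nat) : valuation LM :=
  fun s => match s return nat -> lt_dom M s with
           | Some s => v s
           | None => fun _ => n
           end.

Lemma restr_upd (v : valuation LM) s x (d : dom LM (Some s)) :
  restr (upd v x d) = upd (M := snapshot) (restr v) x (s := s) d.
Proof.
apply: functional_extensionality_dep => s'; apply: functional_extensionality_dep => y.
rewrite /restr; have [[? ?]|ne] := pselect ((s', y) = (s, x)).
  by subst s' y; rewrite !updE.
by rewrite !upd_neq // => -[? ?]; apply: ne; congr pair.
Qed.

(** As [times] excludes quantification over Time, this keeps the condition [on_time (v None)]
    unchanged below quantifiers. *)
Lemma upd_time (v : valuation LM) s x (d : dom LM (Some s)) :
  upd v x d None = v None.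
Proof. by apply: functional_extensionality_dep => y; rewrite upd_neq. Qed.

Section Translation.
Variable k : tterm -> K.

(* The copy chosen by [k] for the Time-term [u] is interpreted at the value of
   [u]. *)
Definition on_time (w : nat -> nat) (u : tterm) : Prop := tm (k u) = teval w u.

Lemma eval_time (v : valuation LM) (u : @term (lt_vocab L) None) :
  eval v u = teval (v None) (time_of u).
Proof.
move: u; suff H s (u : @term (lt_vocab L) s) :
  match s return @term (lt_vocab L) s -> Prop with
  | Some _ => fun _ => True
  | None => fun u => eval v u = teval (v None) (time_of u)
  end u by exact: (H None).
elim: u => [[s'|] x|[||f|f] a IH] //=.
by congr S; apply: (IH tt).
Qed.

Lemma eval_te (v : valuation LM) s (u : @term (lt_vocab L) (Some s)) :
  term_times (on_time (v None)) u ->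
  eval (M := snapshot) (restr v) (te_term k u) = eval v u.
Proof.
move: u; suff H s' (u : @term (lt_vocab L) s') :
  match s' return @term (lt_vocab L) s' -> Prop with
  | Some s => fun u => term_times (on_time (v None)) u ->
      eval (M := snapshot) (restr v) (te_term k u) = eval v u
  | None => fun _ => True
  end u by exact: (H (Some s)).
elim: u => [[s2|] x|[||f|f] a IH] //= hP.
- by congr sfint; apply: functional_extensionality_dep => i; apply: IH.
- have := hP None; rewrite term_times_None eval_time => ->.
  congr dfint; apply: functional_extensionality_dep => i.
  exact: (IH (Some i) (hP (Some i))).
Qed.

Lemma eval_te_atom (v : valuation LM) (a : atom (@term (lt_vocab L))) :
  atom_times (on_time (v None)) a ->
  embed_atom (eval_atom (M := snapshot) (restr v) (te_atom k a)) = eval_atom v a.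
Proof.
case: a => [[p|p] a] hP; rewrite /eval_atom /=; congr Atom;
  apply: functional_extensionality_dep => i.
  by rewrite eval_te //; apply: hP.
case: i => [i|]; first by rewrite eval_te //; apply: (hP (Some i)).
by rewrite eval_time; have := hP None; rewrite term_times_None.
Qed.

(** [X] and [Y] are arbitrary because rule bodies are evaluated at all stages of the alternating
    fixpoint, not only at the true atoms. *)
Lemma holds_te X Y (v : valuation LM) (A : form (lt_vocab L)) :
  times (on_time (v None)) A ->
  holds (embed_atom @^-1` X) (embed_atom @^-1` Y) (restr v) (te k A)
  = holds X Y v A.
Proof.
elim: A X Y v => [|a|s u w|A IH|A IHA B IHB|A IHA B IHB|s x A IH|s x A IH]
  X Y v //=.
- by move=> hP; rewrite -(eval_te_atom hP).
- by case: s u w => [s|] u w [//= _ hu hw]; rewrite !eval_te.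
- by move=> /IH->.
- by move=> [/IHA-> /IHB->].
- by move=> [/IHA-> /IHB->].
- case: s => [s|] [//= _ hA].
  by apply: propext; split=> h d; move: (h d); rewrite -restr_upd IH // upd_time.
- case: s => [s|] [//= _ hA].
  by apply: propext; split=> -[d h]; exists d; move: h; rewrite -restr_upd IH // upd_time.
Qed.

Lemma true_atoms_snapshot :
  true_atoms (M := snapshot) = embed_atom @^-1` true_atoms (M := LM).
Proof. by apply/seteqP; split=> -[[p|[? p]] a]. Qed.

Lemma holds_te_extend (v : valuation snapshot) n (A : form (lt_vocab L)) :
  times (on_time (fun=> n)) A ->
  holds (@true_atoms _ snapshot) (@true_atoms _ snapshot) v (te k A)
  = holds (@true_atoms _ LM) (@true_atoms _ LM) (extend v n) A.
Proof.
by rewrite true_atoms_snapshot; apply: (@holds_te _ _ (extend v n)).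
Qed.

Lemma sat_te n (A : form (lt_vocab L)) :
  times (on_time (fun=> n)) A -> sat LM A -> sat snapshot (te k A).
Proof. by move=> hA sA v; rewrite (holds_te_extend _ hA). Qed.

Lemma simulates_te (v : valuation LM) (r : rule (lt_vocab L)) :
  rule_times (on_time (v None)) r ->
  simulates embed_atom (te_rule k r) (restr v) r v.
Proof. by move=> [hh hb]; split=> [|X Y]; [apply: eval_te_atom | rewrite holds_te]. Qed.

End Translation.

Variable ti : nat -> K.
Hypothesis tmK : cancel tm ti.

(** By [tmK] distinct copies have distinct times, so the time of an embedded atom reveals its copy.
    Off the image of [embed_atom] the value is arbitrary. *)
Definition unembed_atom (a : atom (dom LM)) : atom (dom snapshot) :=
  match a with
  | Atom (SPred p) a => @Atom (state_vocab L K) (dom snapshot) (inl p) a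
  | Atom (DPred p) a =>
    @Atom (state_vocab L K) (dom snapshot) (inr (ti (a None), p))
      (fun i => a (Some i))
  end.

Definition atom_time (a : atom (dom LM)) : nat :=
  match a with
  | Atom (SPred _) _ => 0
  | Atom (DPred _) a => a None
  end.

Lemma embed_atomK : cancel embed_atom unembed_atom.
Proof. by case=> [[p|[c p]] a] //=; rewrite tmK. Qed.

Variables (D : set (rule (lt_vocab L))) (D' : set (rule (state_vocab L K))).

Hypothesis lift_te : forall r', D' r' -> exists r k n,
  [/\ D r, r' = te_rule k r & rule_times (on_time k (fun=> n)) r].

Hypothesis static_te : forall r, D r -> head_time r = None ->
  exists k, D' (te_rule k r) /\ forall w, rule_times (on_time k w) r.

(** The choice [k] may depend on the instance: a single-state rule has two projections in the
    transition theory, and the time of the head decides which one matches. *)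
Hypothesis dynamic_te : forall r u p c w, D r -> head_time r = Some u ->
  asym (rhead r) = DPred p -> teval w u = tm c -> defined D' (inr (c, p)) ->
  exists k, D' (te_rule k r) /\ rule_times (on_time k w) r.

Lemma sat_defn_snapshot : sat_defn LM D -> sat_defn snapshot D'.
Proof.
apply: (@sat_defn_project _ _ _ _ _ _ embed_atom true_atoms_snapshot).
- move=> a [r' /lift_te [r [k [n [Dr -> _]]]] ha]; exists r => //.
  by case: r ha {Dr} => [[[q|q] b] ?] /=; case: a => [[p|[c p]] a] //= [];
    [move=> <-|move=> _ <-].
- move=> r' v' /lift_te [r [k [n [Dr -> hr]]]].
  by exists r, (extend v' n); split=> //; apply: (@simulates_te k (extend v' n)).
- move=> r v a Dr ea df.
  suff [k [Dk hr]] : exists k, D' (te_rule k r) /\ rule_times (on_time k (v None)) r.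
    have sim := simulates_te hr.
    exists (te_rule k r), (restr v); split=> //.
    by rewrite -[LHS]embed_atomK -ea -(proj1 sim) embed_atomK.
  case ht: (head_time r) => [u|]; last first.
    by have [k [? ?]] := static_te Dr ht; exists k.
  case: a df ea => [[p|[c p]] a] /= df; first by case: r ht {Dr} => [[[q|q] b] ?].
  move=> ea; apply: (@dynamic_te r u p c _ Dr ht _ _ df).
    exact: (congr1 (@asym _ _) ea).
  have /= := congr1 atom_time ea.
  by case: r ht {Dr ea} => [[[q|q] b] ?] //= [<-]; rewrite -eval_time.
Qed.

End Snapshots.

(** * Snapshots as models of the initial and transition theories *)

Section InitialAndTransition.
Variables (L : ltvoc) (T : theory (lt_vocab L)) (M : lt_structure L).
Hypothesis ltcT : ltc_theory T.
Hypothesis modT : models (lt_str M) T.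

Lemma static_rule_head (r : rule (lt_vocab L)) u :
  rule_static r -> head_time r <> Some u.
Proof. by move=> hr; apply: head_time_times. Qed.

(** Here and in the next three lemmas the Time-term of the head fixes the kind of the rule: by
    stratification for static heads and heads at a variable, by exclusion of the other kinds for
    [Init] and [Succ]. *)
Lemma defn_head_None r : defn T r -> head_time r = None -> rule_static r.
Proof. by case: ltcT => _ _ _ [h _] Dr e; have := h r Dr; rewrite e. Qed.

Lemma defn_head_init r : defn T r -> head_time r = Some TInit -> rule_initial r.
Proof.
case: ltcT => _ _ h _ Dr e; case: (h r Dr) => [/static_rule_head/(_ e)|//||] //.
- by move=> [t [_ /head_time_times/(_ e)]].
- by move=> [t [_ /head_time_times/(_ e)]] [].
Qed.

Lemma defn_head_var r x :
  defn T r -> head_time r = Some (TVar x) -> rule_single_state x r.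
Proof. by case: ltcT => _ _ _ [h _] Dr e; have := h r Dr; rewrite e. Qed.

Lemma defn_head_succ r u : defn T r -> head_time r = Some (TSucc u) ->
  exists2 x, u = TVar x & rule_bistate x r.
Proof.
case: ltcT => _ _ h _ Dr e; case: (h r Dr).
- by move=> /static_rule_head/(_ e).
- by move=> [_ /head_time_times/(_ e)].
- by move=> [t [_ /head_time_times/(_ e)]].
- move=> [t bt]; exists t => //.
  by case: bt => _ /head_time_times/(_ e) [//|[]].
Qed.

Definition initial_state : structure (ss_vocab L) := snapshot M (fun=> 0).

(** Coercing [b] to a number places the current-state copy at [n] and the next-state copy at
    [n.+1]. *)
Definition transition (n : nat) : structure (bs_vocab L) :=
  snapshot M (fun b : bool => n + b).

(** After the shift every Time-term is a successor. The right-hand side allows the unshifted formula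
    to be read directly at time [n.+1]. *)
Lemma te_bs_shift x (A : form (lt_vocab L)) : times (is_cur x) A ->
  te_bs (shift x A) = te (fun=> true) A.
Proof.
move=> hA; apply: te_repl; apply: times_mono hA => _ -> /=.
by rewrite /next_var eqxx.
Qed.

Lemma te_rule_bs_shift x (r : rule (lt_vocab L)) : rule_times (is_cur x) r ->
  te_rule_bs (rule_shift x r) = te_rule (fun=> true) r.
Proof.
move=> hr; apply: te_repl_rule; apply: rule_times_mono hr => _ -> /=.
by rewrite /next_var eqxx.
Qed.

Lemma te_rule_ss_uninit (r : rule (lt_vocab L)) : rule_initial r ->
  te_rule_ss (rule_uninit 0 r) = te_rule_ss r.
Proof. by move=> [_ hr]; apply: te_repl_rule; apply: rule_times_mono hr. Qed.

Lemma initial_state_models : models initial_state (initial_theory T).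
Proof.
have [satM defM] := modT; split=> [A'|].
  case=> [[[A [/satM sA hA] <-]|[A [/satM sA [_ hA]] <-]]
         |[A [/satM sA [x [B eA hB]]] <-]].
  - by apply: (@sat_te _ _ _ _ _ 0) => //; apply: times_mono hA.
  - have -> : te_ss (@All (lt_vocab L) None 0 (uninit 0 A)) = te_ss A.
      by apply: te_repl; apply: times_mono hA.
    by apply: (@sat_te _ _ _ _ _ 0) => //; apply: times_mono hA => _ ->.
  - move: sA; rewrite eA => /sat_All sB.
    by apply: (@sat_te _ _ _ _ _ 0 B) => //; apply: times_mono hB => _ ->.
apply: (@sat_defn_snapshot _ _ _ _ (fun=> tt)) defM; first by case.
- move=> r' [[[r [Dr hr] <-]|[r [Dr hr] <-]]|[r [Dr [x [_ hr]]] <-]];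
    exists r, (fun=> tt), 0; split=> //; rewrite ?te_rule_ss_uninit //.
  + by apply: rule_times_mono hr.
  + by apply: rule_times_mono (proj2 hr) => _ ->.
  + by apply: rule_times_mono hr => _ ->.
- move=> r Dr /(defn_head_None Dr) hr; exists (fun=> tt); split.
    by left; left; exists r.
  by move=> w; apply: rule_times_mono hr.
(* The head of the instance is at time 0, which rules out a successor. *)
- move=> r [x| |u] p c w Dr e _ //= ew _; exists (fun=> tt); split.
  + by right; exists r => //; split=> //; exists x; apply: defn_head_var.
  + have [_ hr] := defn_head_var Dr e.
    by apply: rule_times_mono hr => _ ->; rewrite /on_time /= ew.
  + have hr := defn_head_init Dr e; left; right.
    by exists r => //; apply: te_rule_ss_uninit.
  + have [_ hr] := defn_head_init Dr e.
    by apply: rule_times_mono hr => _ ->.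
Qed.

(* A predicate whose current-state copy is defined in the transition theory has
   a single-state rule; by stratification all its rules are then single-state. *)
Lemma defined_current (p : dpsym L) r :
  defined (V := bs_vocab L) (defn (transition_theory T)) (inr (false, p)) ->
  defn T r -> asym (rhead r) = DPred p -> exists x, rule_single_state x r.
Proof.
move=> [r' Dr' hr'] Dr pr.
have [_ _ _ [_ strat]] := ltcT.
have K k r0 : te_rule k r0 = r' -> asym (rhead r0) = DPred p /\
    exists2 u, head_time r0 = Some u & k u = false.
  move=> E; move: hr'; rewrite -E; case: r0 {E} => [[[q|q] a] b] //= [].
  by move=> <- <-; split=> //; eexists.
suff [r0 [Dr0 pr0 ss0]] : exists r0,
    [/\ defn T r0, asym (rhead r0) = DPred p & exists x, rule_single_state x r0].
  by apply: (strat r0); rewrite ?pr0.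
(* A static rule has no dynamic head, a shifted rule defines a next-state copy, and a bistate rule
   with head at [t] is single-state by stratification. *)
move: Dr' => [[[[r0 [D0 h0] E]|[r0 [D0 h0] E]]|[r0 [x [D0 h0 E]]]]|[r0 [D0 h0] E]].
- by have [_ [u /(static_rule_head h0)]] := K _ _ E.
- by exists r0; have [] := K _ _ E.
- by move: E; rewrite (te_rule_bs_shift (proj2 h0)) => /esym/K [_ []].
- have [p0 [u hu ku]] := K _ _ E; exists r0; split=> //.
  case: h0 => x [_ /head_time_times/(_ hu) [eu|eu]]; last by rewrite eu in ku.
  by exists x; apply: defn_head_var; rewrite -?eu.
Qed.

Lemma transition_models n : models (transition n) (transition_theory T).
Proof.
have [satM defM] := modT; split=> [A'|].
  case=> [[[[A [/satM sA hA] <-]|[A [/satM sA [x [B eA hB]]] <-]]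
          |[A [x [/satM sA [B eA hB] ->]]]]
         |[A [/satM sA [x [B eA hB]]] <-]].
  - by apply: (@sat_te _ _ _ _ _ n) => //; apply: times_mono hA.
  - move: sA; rewrite eA => /sat_All sB; apply: (@sat_te _ _ _ _ _ n B) => //.
    by apply: times_mono hB => _ ->; rewrite /on_time /= addn0.
  - move: sA; rewrite eA => /sat_All sB.
    have -> : te_bs (shift x (@All (lt_vocab L) None x B)) = te (fun=> true) B.
      exact: (te_bs_shift hB).
    apply: (@sat_te _ _ _ _ _ n.+1 B) => //.
    by apply: times_mono hB => _ ->; rewrite /on_time /= addn1.
  - move: sA; rewrite eA => /sat_All sB; apply: (@sat_te _ _ _ _ _ n B) => //.
    by apply: times_mono hB => _ [->|->]; rewrite /on_time /= ?addn0 ?addn1.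
(* The test [n < m] sends [n] to [false] and [n.+1] to [true], inverting [b => n + b]. *)
apply: (@sat_defn_snapshot _ _ _ _ (fun m => n < m)) defM.
- by case; rewrite /= ?addn1 ?addn0 ?ltnn ?ltnSn.
- move=> r' [[[[r [Dr hr] <-]|[r [Dr [x [_ hr]]] <-]]
             |[r [x [Dr [_ hr] ->]]]]|[r [Dr [x [_ hr]]] <-]].
  + by exists r, (@is_succ), n; split=> //; apply: rule_times_mono hr.
  + exists r, (@is_succ), n; split=> //; apply: rule_times_mono hr => _ ->.
    by rewrite /on_time /= addn0.
  + exists r, (fun=> true), n.+1; split=> //; first exact: te_rule_bs_shift.
    by apply: rule_times_mono hr => _ ->; rewrite /on_time /= addn1.
  + exists r, (@is_succ), n; split=> //; apply: rule_times_mono hr => _ [->|->];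
      by rewrite /on_time /= ?addn0 ?addn1.
- move=> r Dr /(defn_head_None Dr) hr; exists (@is_succ); split.
    by left; left; left; exists r.
  by move=> w; apply: rule_times_mono hr.
move=> r u p c w Dr e pr ew df.
(* A head in the current state whose copy is defined must be at a variable; this excludes [Init]
   when [n] is 0 and [Succ] when its value is [n]. *)
have single : c = false -> exists x, u = TVar x.
  move=> c0; rewrite c0 in df.
  have [x [_ /head_time_times/(_ e)]] := defined_current df Dr pr.
  by exists x.
case: u e ew single => [x| |u] e /= ew single.
- have hr := defn_head_var Dr e; case: c ew {df single} => ew.
  + exists (fun=> true); split.
      left; right; exists r, x; split=> //.
      by rewrite te_rule_bs_shift //; apply: (proj2 hr).
    by apply: rule_times_mono (proj2 hr) => _ ->.
  + exists (@is_succ); split; first by left; left; right; exists r => //; split=> //; exists x.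
    by apply: rule_times_mono (proj2 hr) => _ ->.
- by case: c ew single {df} => [|_ /(_ erefl) [] //]; rewrite addn1.
- have [x eu hr] := defn_head_succ Dr e; subst u.
  case: c ew single {df} => [ew _|_ /(_ erefl) [] //].
  move: ew; rewrite /= addn1 => -[ew].
  exists (@is_succ); split; first by right; exists r => //; split=> //; exists x.
  by apply: rule_times_mono (proj2 hr) => _ [->|->]; rewrite /on_time /= ?addn0 ?addn1 ew.
Qed.

End InitialAndTransition.

(** * The induction on time *)

Lemma models_add_Neg V (J : structure V) (T : theory V) (A : form V) :
  models J T -> ~ models J (add_sent T (Neg A)) ->
  exists v, holds (@true_atoms _ J) (@true_atoms _ J) v A.
Proof.
move=> [sJ dJ] h; apply: contrapT => nh; apply: h; split=> // B [/sJ//|->] v.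
by move=> hA; apply: nh; exists v.
Qed.

Lemma models_add V (J : structure V) (T : theory V) (A : form V) :
  models J T -> sat J A -> models J (add_sent T A).
Proof. by move=> [sJ dJ] sA; split=> // B [/sJ//|->]. Qed.

Theorem theorem4 (L : ltvoc) (T : theory (lt_vocab L))
    (I : structure (static_vocab L)) (t : nat) (phi : form (lt_vocab L)) :
  ltc_theory T ->
  sentence phi ->
  univ_single_state t phi ->
  ~ (exists J : structure (ss_vocab L),
       expands J I /\
       models J (add_sent (initial_theory T) (Neg (te_ss phi)))) ->
  ~ (exists J : structure (bs_vocab L),
       expands J I /\
       models J (add_sent (add_sent (transition_theory T) (te_bs phi))
                          (Neg (te_bs (shift t phi))))) ->
  forall M : lt_structure L,
    lt_expands M I -> models (lt_str M) T -> sat (lt_str M) phi.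
Proof.
move=> ltcT sphi [B ephi hB] base step M MI modT.
pose holdsM := holds (@true_atoms _ (lt_str M)) (@true_atoms _ (lt_str M)).
(* [models_add_Neg] yields just one valuation, as [sat] of a negation asks for falsity under all of
   them. Since [phi] is a sentence, only [t] can be free in [B], so one valuation decides for all
   with the same value of [t]. *)
have only_time (v v' : valuation (lt_str M)) :
    v None t = v' None t -> holdsM v B -> holdsM v' B.
  move=> e; rewrite /holdsM (@eq_holds _ _ _ _ v v') // => -[s x] fr.
  have [[? ?]|ne] := pselect ((s, x) = (None, t)); first by subst s x.
  by case: (sphi (s, x)); rewrite ephi.
have B0 : times (@on_time unit (fun=> 0) (fun=> tt) (fun=> 0)) B.
  by apply: times_mono hB => _ ->.
have Bn n : times (@on_time bool (fun b => n + b) is_succ (fun=> n)) B.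
  by apply: times_mono hB => _ ->; rewrite /on_time /= addn0.
have BSn n : times (@on_time bool (fun b => n + b) (fun=> true) (fun=> n.+1)) B.
  by apply: times_mono hB => _ ->; rewrite /on_time /= addn1.
rewrite ephi; apply/sat_All => v.
suff: forall n w, w None t = n -> holdsM w B by apply.
elim=> [|n IH] w wt.
- have [|v'] := models_add_Neg (initial_state_models ltcT modT) (A := te_ss phi).
    by move=> m; apply: base; exists (initial_state M).
  rewrite ephi [X in X -> _](holds_te_extend v' B0).
  by apply: only_time; rewrite wt.
- have tn : models (transition M n) (add_sent (transition_theory T) (te_bs phi)).
    apply: models_add; first exact: transition_models.
    rewrite ephi => v'; have := IH (extend v' n) erefl.
    by rewrite /holdsM -(holds_te_extend v' (Bn n)).
  have [|v'] := models_add_Neg tn (A := te_bs (shift t phi)).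
    by move=> m; apply: step; exists (transition M n).
  have -> : te_bs (shift t phi) = te (fun=> true) B.
    by rewrite ephi; apply: (te_bs_shift hB).
  rewrite [X in X -> _](holds_te_extend v' (BSn n)).
  by apply: only_time; rewrite wt.
Qed.
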